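(* Let $n\in\mathbb N$ be fixed and let $\mathcal X,\mathcal Y$ be finite alphabets. The set $$S^{FB}_{SE}(\text{solvable})=\{(A,W)\in \mathcal M_c^{n\times n}\times \mathcal{CH}_c(\mathcal X,\mathcal Y): C_0^{FB}(W)>\eta(A)\}\subset \mathcal M_c^{n\times n}\times \mathcal{CH}_c(\mathcal X,\mathcal Y)$$ is not semi-decidable (for channels with feedback).
   Context: Computability. A sequence of rationals $(r_k)_{k\in\mathbb N}$ is computable if there are partial recursive functions $a,b,s:\mathbb N\to\mathbb N$ with $b(k)\neq 0$ and $r_k=(-1)^{s(k)}a(k)/b(k)$ for all $k\in\mathbb N$. A real $x$ is computable if there is a computable sequence of rationals $(r_k)$ with $|x-r_k|<2^{-k}$ for all $k$; $\mathbb R_c$ is the set of computable reals. A computable real is given as input to a Turing machine by a description (a program) of such a sequence; computable matrices and computable channels are given by descriptions of all their entries. A subset $M$ of a set $D$ of such objects is semi-decidable if there is a Turing machine (with the single output state ''stop'') that, for every input in $D$, stops if the input lies in $M$ and computes forever if it does not. Plants. $\mathcal M_c^{n\times n}$ is the set of $n\times n$ matrices $A$ with entries in $\mathbb R_c$ that describe an unstable system, i.e. have at least one eigenvalue $\lambda$ with $|\lambda|\ge 1$. With $\lambda_1(A),\dots,\lambda_n(A)$ the (complex) eigenvalues of $A$ repeated according to algebraic multiplicity, $\eta(A)=\sum_{j:|\lambda_j(A)|\ge 1}\log_2|\lambda_j(A)|$. Channels. $\mathcal{CH}_c(\mathcal X,\mathcal Y)$ is the set of computable channels, i.e. families $W=(W(y|x))_{x\in\mathcal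 X,y\in\mathcal Y}$ such that for each $x$, $W(\cdot|x)$ is a probability distribution on $\mathcal Y$ with all values in $\mathbb R_c$. For $x^m\in\mathcal X^m$, $y^m\in\mathcal Y^m$ let $W^m(y^m|x^m)=\prod_{j=1}^m W(y_j|x_j)$. Let $M(W,m)$ be the maximum cardinality of a set of mutually orthogonal vectors (vectors with pairwise disjoint supports) among the $W^m(\cdot|x^m)$ with $x^m\in\mathcal X^m$. The zero-error capacity is $C_0(W)=\liminf_{m\to\infty}\frac1m\log_2 M(W,m)$. The zero-error capacity with feedback is given by (Shannon) $C_0^{FB}(W)=0$ if $C_0(W)=0$, and otherwise $$C_0^{FB}(W)=\max_{P}\min_{y\in\mathcal Y}\log_2\frac{1}{\sum_{x:W(y|x)>0}P(x)},$$ where $P$ ranges over all probability distributions on $\mathcal X$ (with $\log_2(1/0)=+\infty$).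
   Formalization: The formal theorem assumes n ≥ 1 and that both alphabets have at least two letters; for n = 0, or when an alphabet has only one letter, the set is empty and hence semi-decidable, so the claim fails there. *)

(* Defs.v *)
From HB Require Import structures.
From mathcomp Require Import all_boot all_order all_algebra.
From mathcomp Require Import all_classical all_reals all_analysis.
From mathcomp Require Import complex.

Set Implicit Arguments.
Unset Strict Implicit.
Unset Printing Implicit Defensive.

Import Order.TTheory GRing.Theory Num.Theory.

Local Open Scope classical_set_scope.
Local Open Scope ring_scope.

(** * Partial recursive functions and their programs *)

(** Kleene's schemes.  Programs carry no arity: a program is run on a list of
    arguments, and a run that needs an argument beyond the end of the list has no
    result.  The k-ary partial recursive functions are the restrictions of programs to
    argument lists of length k. *)
Inductive prog : Type :=
| PZero
| PSucc
| PProj of nat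
| PComp of prog & seq prog
| PRec of prog & prog
| PMu of prog.

(** [pr_eval p xs v]: the run of [p] on the arguments [xs] terminates with value
    [v].  Primitive recursion is on the first argument, with
    h(0, xs) = f(xs) and h(n + 1, xs) = g(n, h(n, xs), xs); minimization
    searches for the least first argument at which f vanishes, f being defined
    at all smaller ones. *)
Inductive pr_eval : prog -> seq nat -> nat -> Prop :=
| EvZero xs : pr_eval PZero xs 0
| EvSucc x xs : pr_eval PSucc (x :: xs) x.+1
| EvProj i xs : (i < size xs)%N -> pr_eval (PProj i) xs (nth 0%N xs i)
| EvComp f gs xs ys v :
    size ys = size gs ->
    (forall i, (i < size gs)%N -> pr_eval (nth PZero gs i) xs (nth 0%N ys i)) ->
    pr_eval f ys v -> pr_eval (PComp f gs) xs v
| EvRec0 f g xs v : pr_eval f xs v -> pr_eval (PRec f g) (0%N :: xs) v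
| EvRecS f g n xs u v :
    pr_eval (PRec f g) (n :: xs) u -> pr_eval g [:: n, u & xs] v ->
    pr_eval (PRec f g) (n.+1 :: xs) v
| EvMu f xs n (us : nat -> nat) :
    (forall i, (i < n)%N -> pr_eval f (i :: xs) (us i).+1) ->
    pr_eval f (n :: xs) 0 -> pr_eval (PMu f) xs n.

(** Gödel numbers; [CodeSeq.code] is a bijection from [seq nat] to [nat]. *)
Fixpoint godel (p : prog) : nat :=
  match p with
  | PZero => CodeSeq.code [:: 0]
  | PSucc => CodeSeq.code [:: 1]
  | PProj i => CodeSeq.code [:: 2; i]
  | PComp f gs => CodeSeq.code [:: 3, godel f & [seq godel g | g <- gs]]
  | PRec f g => CodeSeq.code [:: 4; godel f; godel g]
  | PMu f => CodeSeq.code [:: 5; godel f]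
  end%N.

(** * Turing machines *)

Inductive move := MLeft | MStay | MRight.

(** Deterministic machines with one two-way infinite tape.  The transition out
    of [stop] is irrelevant, since a run ends when [stop] is reached. *)
Record turing_machine := TuringMachine {
  tm_state : finType;
  tm_symbol : finType;
  blank : tm_symbol;
  mark : tm_symbol;
  mark_neq_blank : mark != blank;
  start : tm_state;
  stop : tm_state;
  delta : tm_state -> tm_symbol -> tm_state * tm_symbol * move
}.

(** The tape is [rev cf_left], then the scanned symbol, then [cf_right], with
    blanks everywhere else; [cf_left] thus lists the symbols to the left of the
    head starting with the nearest one. *)
Record config (T : turing_machine) := Config {
  cf_state : tm_state T;
  cf_left : seq (tm_symbol T);
  cf_head : tm_symbol T;
  cf_right : seq (tm_symbol T)
}.

Definition tm_step (T : turing_machine) (c : config T) : config T :=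
  let: Config q l a r := c in
  let: (q', a', d) := delta q a in
  match d with
  | MLeft => Config q' (behead l) (head (blank T) l) (a' :: r)
  | MStay => Config q' l a' r
  | MRight => Config q' (a' :: l) (head (blank T) r) (behead r)
  end.

(** A list of numbers is written in unary, each number [e] as [e] marks followed
    by one blank. *)
Definition tape_of (T : turing_machine) (es : seq nat) : seq (tm_symbol T) :=
  flatten [seq rcons (nseq e (mark T)) (blank T) | e <- es].

Definition tm_init (T : turing_machine) (es : seq nat) : config T :=
  Config (start T) [::] (head (blank T) (tape_of T es))
    (behead (tape_of T es)).

Definition halts (T : turing_machine) (es : seq nat) : Prop :=
  exists k : nat, cf_state (iter k (@tm_step T) (tm_init T es)) = stop T.

(** [descr t es] means that [es] is a description of the object [t]; an object
    has many descriptions, and the machine must answer correctly on each of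
    them.  Nothing is required of it on other inputs. *)
Definition semi_decidable (O : Type) (descr : O -> seq nat -> Prop)
    (D M : set O) : Prop :=
  exists T : turing_machine,
    forall t es, D t -> descr t es -> (halts T es <-> M t).

(** * Computable reals *)

Record real_descr := RealDescr {
  rd_num : prog;
  rd_den : prog;
  rd_sgn : prog
}.

Definition describes_real (R : realType) (d : real_descr) (x : R) : Prop :=
  forall k : nat, exists a b s : nat,
    [/\ pr_eval (rd_num d) [:: k] a, pr_eval (rd_den d) [:: k] b,
        pr_eval (rd_sgn d) [:: k] s, b != 0%N
      & `|x - (-1) ^+ s * (a%:R / b%:R)| < 2 ^- k].

Definition computable_real (R : realType) (x : R) : Prop :=
  exists d : real_descr, describes_real d x.

Definition real_descr_codes (d : real_descr) : seq nat :=
  [:: godel (rd_num d); godel (rd_den d); godel (rd_sgn d)].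

(** * Plants *)

Definition log2 (R : realType) (x : R) : R := ln x / ln 2.

Definition complex_mx (R : realType) (n : nat) (A : 'M[R]_n) : 'M[R[i]]_n :=
  map_mx (real_complex R) A.

(** The eigenvalues repeated according to algebraic multiplicity: the
    characteristic polynomial is the product of the ['X - z%:P] for [z] in this
    list. *)
Definition spectrum (R : realType) (n : nat) (A : 'M[R]_n) : seq R[i] :=
  sval (closed_field_poly_normal (char_poly (complex_mx A))).

(** [Normc.normc z] is the modulus of [z] as an element of [R] ([`|z|] lives in
    [R[i]]). *)
Definition eta (R : realType) (n : nat) (A : 'M[R]_n) : R :=
  \sum_(z <- spectrum A | 1 <= Normc.normc z) log2 (Normc.normc z).

Definition plants (R : realType) (n : nat) : set 'M[R]_n :=
  [set A : 'M[R]_n | (forall i j, computable_real (A i j)) /\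
           exists2 z : R[i], eigenvalue (complex_mx A) z
                           & 1 <= Normc.normc z].

(** * Channels *)

(** [W x y] stands for W(y|x). *)
Definition channel (R : realType) (X Y : finType) := X -> Y -> R.

Definition is_distr (R : realType) (X : finType) (P : X -> R) : Prop :=
  (forall x, 0 <= P x) /\ \sum_x P x = 1.

Definition channels (R : realType) (X Y : finType) : set (channel R X Y) :=
  [set W : channel R X Y | (forall x, is_distr (W x)) /\
           forall x y, computable_real (W x y)].

Section Capacity.
Variables (R : realType) (X Y : finType) (W : channel R X Y).

Definition channel_pow (m : nat) (xs : m.-tuple X) (ys : m.-tuple Y) : R :=
  \prod_(j < m) W (tnth xs j) (tnth ys j).

Definition disjoint_supports (m : nat) (xs xs' : m.-tuple X) : bool :=
  [forall ys : m.-tuple Y,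
     (channel_pow xs ys == 0) || (channel_pow xs' ys == 0)].

(** The vectors are counted through their input words: as each of them is
    nonzero, two words giving the same vector do not have disjoint supports. *)
Definition max_orthogonal (m : nat) : nat :=
  \max_(S : {set m.-tuple X} |
        [forall xs in S, forall xs' in S,
           (xs != xs') ==> disjoint_supports xs xs']) #|S|.

Definition C0 : \bar R :=
  limn_einf (fun m : nat => (m%:R^-1 * log2 (max_orthogonal m)%:R)%:E).

Definition elog2 (x : \bar R) : \bar R := (lne x * (ln 2)^-1%:E)%E.

(** In [\bar R], [0^-1 = +oo] and [lne +oo = +oo].  When [W] is a channel, the
    supremum over [P] is attained (compactness of the simplex). *)
Definition C0FB : \bar R :=
  if C0 == 0%E then 0%E
  else ereal_sup [set \big[mine/+oo%E]_(y : Y)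
                        elog2 ((\sum_(x | 0 < W x y) P x)%:E^-1)%E
                 | P in [set P : X -> R | is_distr P]].

End Capacity.

(** * Plant-channel pairs *)

Definition describes_pair (R : realType) (n : nat) (X Y : finType)
    (AW : 'M[R]_n * channel R X Y) (es : seq nat) : Prop :=
  exists (dA : 'I_n -> 'I_n -> real_descr) (dW : X -> Y -> real_descr),
    [/\ forall i j, describes_real (dA i j) (AW.1 i j),
        forall x y, describes_real (dW x y) (AW.2 x y)
      & es = flatten
          ([seq real_descr_codes (dA i j) | i <- enum 'I_n, j <- enum 'I_n] ++
           [seq real_descr_codes (dW x y) | x <- enum X, y <- enum Y])].

Definition S_FB_SE_solvable (R : realType) (n : nat) (X Y : finType) :
    set ('M[R]_n * channel R X Y) :=
  [set AW : 'M[R]_n * channel R X Y |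
      [/\ plants AW.1, channels AW.2
        & ((eta AW.1)%:E < C0FB AW.2)%E]].

Arguments S_FB_SE_solvable : clear implicits.
Arguments plants : clear implicits.
Arguments channels : clear implicits.

(* Main.v *)
Require Import Defs.
From mathcomp Require Import all_boot all_order all_algebra.
From mathcomp Require Import all_classical all_reals all_analysis.
From mathcomp Require Import complex ring lra.

Set Implicit Arguments.
Unset Strict Implicit.
Unset Printing Implicit Defensive.

(** The feedback capacity is discontinuous in a way that encodes an equality
    test.  Fix two input letters [x0], [x1] and two output letters [y0], [y1],
    and let [x0] always produce [y0], while every other input produces [y0] with
    probability [e] and [y1] with probability [1 - e].  If [e = 0], then [x0] and
    [x1] are perfectly distinguishable, so that [C0FB] is at least one bit
    ([C0FB_zchannel0]).  If [e > 0], all words can produce the constant output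
    word [y0 ... y0], no two of them are orthogonal, and [C0FB] vanishes
    ([C0FB_zchannel_pos]).  For the identity plant [eta] is [0] ([eta1]), hence
    this channel solves the problem exactly when [e = 0].

    No machine semi-decides [e = 0], by diagonalization.  Given a machine [T],
    choose [e = 2 ^- m] if [T] stops after [m] steps on the description of the
    pair, and [e = 0] if it never stops ([halting_real]): then [T] halts on that
    description exactly when the pair is not in the set.  The choice is circular,
    since the description of the pair contains programs for [e].  The circle is
    closed as in Kleene's recursion theorem: every total recursive function of
    [k] and [g] is computed, at [g] equal to the Goedel number of [p], by some
    program [p] ([self_reference]).  It is applied to the function that follows
    [T] through its first [k + 1] configurations on the description built from
    the Goedel number [g] ([self_timer]).  This function is recursive because one step of
    [T] is an arithmetical operation on coded configurations
    ([next_configE], [recursive_next_config]), and writing the description on the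
    tape is recursive in [g] ([writable]). *)

(** * Recursive functions *)

(** The functions act on lists, so that the variables of an arithmetical
    expression are the [arg i xs], and the closure lemmas below can be applied
    along the syntax of the expression. *)
Definition recursive (k : nat) (f : seq nat -> nat) : Prop :=
  exists p, forall xs, size xs = k -> pr_eval p xs (f xs).

Definition arg (i : nat) (xs : seq nat) : nat := nth 0 xs i.

Lemma eq_recursive k f g :
  (forall xs, size xs = k -> f xs = g xs) -> recursive k f -> recursive k g.
Proof. by move=> e [p hp]; exists p => xs hxs; rewrite -e //; apply: hp. Qed.

Fixpoint const_prog (c : nat) : prog :=
  if c is c'.+1 then PComp PSucc [:: const_prog c'] else PZero.

Lemma const_progP c xs : pr_eval (const_prog c) xs c.
Proof.
elim: c => [|c IH] /=; first exact: EvZero.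
apply: (@EvComp _ _ _ [:: c]) => //; last exact: EvSucc.
by case.
Qed.

Lemma recursive_const k c : recursive k (fun=> c).
Proof. by exists (const_prog c) => xs _; apply: const_progP. Qed.

Lemma recursive_arg k i : i < k -> recursive k (arg i).
Proof. by move=> ik; exists (PProj i) => xs e; apply: EvProj; rewrite e. Qed.

Lemma recursive_comp k f (gs : seq (seq nat -> nat)) :
    recursive (size gs) f ->
    (forall i, i < size gs -> recursive k (nth (fun=> 0) gs i)) ->
  recursive k (fun xs => f [seq g xs | g <- gs]).
Proof.
move=> [pf hf] hgs.
have [ps [eps hps]] : exists ps : seq prog, size ps = size gs /\
    forall i, i < size gs -> forall xs, size xs = k ->
      pr_eval (nth PZero ps i) xs (nth (fun=> 0) gs i xs).
  elim: gs {hf} hgs => [|g gs IH] hgs; first by exists [::].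
  have [p hp] := hgs 0 isT.
  have [|ps [eps hps]] := IH; first by move=> i; apply: (hgs i.+1).
  exists (p :: ps); split=> [|[|i] //=]; first by rewrite /= eps.
  exact: hps.
exists (PComp pf ps) => xs exs.
apply: (@EvComp _ _ _ [seq g xs | g <- gs]).
- by rewrite size_map.
- by move=> i; rewrite eps => ilt; rewrite (nth_map (fun=> 0)) //; apply: hps.
- by apply: hf; rewrite size_map.
Qed.

Lemma recursive_comp1 k (f : nat -> nat) g :
    recursive 1 (fun xs => f (arg 0 xs)) -> recursive k g ->
  recursive k (fun xs => f (g xs)).
Proof. by move=> hf hg; apply: (recursive_comp (gs := [:: g]) hf) => -[]. Qed.

Lemma recursive_comp2 k (f : nat -> nat -> nat) g1 g2 :
    recursive 2 (fun xs => f (arg 0 xs) (arg 1 xs)) ->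
    recursive k g1 -> recursive k g2 ->
  recursive k (fun xs => f (g1 xs) (g2 xs)).
Proof.
by move=> hf h1 h2; apply: (recursive_comp (gs := [:: g1; g2]) hf) => -[|[]].
Qed.

Lemma recursive_succ k g : recursive k g -> recursive k (fun xs => (g xs).+1).
Proof.
apply: recursive_comp1; exists PSucc => -[|x []] //= _; exact: EvSucc.
Qed.

Lemma recursive_iteri k n f g :
    recursive k n -> recursive k f -> recursive k.+2 g ->
  recursive k (fun xs => iteri (n xs) (fun i u => g [:: i, u & xs]) (f xs)).
Proof.
move=> hn [pf hf] [pg hg].
have hrec : recursive k.+1 (fun ys => iteri (arg 0 ys)
    (fun i u => g [:: i, u & behead ys]) (f (behead ys))).
  exists (PRec pf pg) => -[//|m xs] [exs]; rewrite /arg /=.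
  elim: m => [|m IH] /=; first by apply: EvRec0; apply: hf.
  by apply: (EvRecS IH); apply: hg; rewrite /= exs.
pose args := [seq arg i | i <- iota 0 k].
have args_id xs : size xs = k -> [seq g xs | g <- args] = xs.
  by move=> exs; rewrite -map_comp -[RHS](mkseq_nth 0) exs.
have sargs : size args = k by rewrite size_map size_iota.
rewrite -{1}sargs in hrec.
apply: eq_recursive (recursive_comp (k := k) (gs := n :: args) hrec _).
  by move=> xs exs; rewrite /arg /= args_id.
case=> [|i] //=; rewrite ltnS sargs => ik.
by rewrite (nth_map 0) ?size_iota // nth_iota //; apply: recursive_arg.
Qed.

(** Minimization in the form in which it is used: a total function is recursive as
    soon as its value is the first index at which a recursive test succeeds. *)
Lemma recursive_mu k f g :
    recursive k.+1 f ->
    (forall xs, size xs = k -> f (g xs :: xs) = 0) ->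
    (forall xs i, size xs = k -> i < g xs -> f (i :: xs) != 0) ->
  recursive k g.
Proof.
move=> [p hp] f0 fS; exists (PMu p) => xs exs.
apply: (@EvMu _ _ _ (fun i => (f (i :: xs)).-1)) => [i ig|].
- by rewrite prednK ?lt0n ?fS //; apply: hp; rewrite /= exs.
- by rewrite -(f0 _ exs); apply: hp; rewrite /= exs.
Qed.

Lemma recursive_add k f g :
  recursive k f -> recursive k g -> recursive k (fun xs => f xs + g xs).
Proof.
apply: recursive_comp2.
apply: eq_recursive (recursive_iteri (n := arg 0) (f := arg 1)
  (g := fun ys => (arg 1 ys).+1) _ _ _) => [xs _| | |].
- by elim: (arg 0 xs) => //= m ->.
- exact: recursive_arg.
- exact: recursive_arg.
- by apply/recursive_succ/recursive_arg.
Qed.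

Lemma recursive_mul k f g :
  recursive k f -> recursive k g -> recursive k (fun xs => f xs * g xs).
Proof.
apply: recursive_comp2.
apply: eq_recursive (recursive_iteri (n := arg 0) (f := fun=> 0)
  (g := fun ys => arg 3 ys + arg 1 ys) _ _ _) => [[|x [|y []]] //= _| | |].
- by rewrite /arg /=; elim: x => //= m ->; rewrite mulSn.
- exact: recursive_arg.
- exact: recursive_const.
- by apply: recursive_add; apply: recursive_arg.
Qed.

Lemma recursive_exp k f g :
  recursive k f -> recursive k g -> recursive k (fun xs => f xs ^ g xs).
Proof.
apply: recursive_comp2.
apply: eq_recursive (recursive_iteri (n := arg 1) (f := fun=> 1)
  (g := fun ys => arg 2 ys * arg 1 ys) _ _ _) => [[|x [|y []]] //= _| | |].
- by rewrite /arg /=; elim: y => //= m ->; rewrite expnS.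
- exact: recursive_arg.
- exact: recursive_const.
- by apply: recursive_mul; apply: recursive_arg.
Qed.

Lemma recursive_pred k f : recursive k f -> recursive k (fun xs => (f xs).-1).
Proof.
apply: recursive_comp1.
apply: eq_recursive (recursive_iteri (n := arg 0) (f := fun=> 0)
  (g := arg 0) _ _ _) => [xs _| | |]; try exact: recursive_arg.
- by case: (arg 0 xs).
- exact: recursive_const.
Qed.

Lemma recursive_sub k f g :
  recursive k f -> recursive k g -> recursive k (fun xs => f xs - g xs).
Proof.
apply: recursive_comp2.
apply: eq_recursive (recursive_iteri (n := arg 1) (f := arg 0)
  (g := fun ys => (arg 1 ys).-1) _ _ _) => [xs _| | |].
- by elim: (arg 1 xs) => /= [|m ->]; rewrite ?subn0 // subnS.
- exact: recursive_arg.
- exact: recursive_arg.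
- by apply/recursive_pred/recursive_arg.
Qed.

Lemma recursive_leq k f g :
  recursive k f -> recursive k g -> recursive k (fun xs => (f xs <= g xs : nat)).
Proof.
move=> hf hg; apply: (eq_recursive (f := fun xs => 1 - (f xs - g xs))).
  by move=> xs _; rewrite /leq; case: (f xs - g xs).
by apply: recursive_sub; [apply: recursive_const|apply: recursive_sub].
Qed.

Lemma recursive_eqn k f g :
  recursive k f -> recursive k g -> recursive k (fun xs => (f xs == g xs : nat)).
Proof.
move=> hf hg.
apply: (eq_recursive (f := fun xs => (f xs <= g xs) * (g xs <= f xs))).
  by move=> xs _; rewrite mulnb -eqn_leq.
by apply: recursive_mul; apply: recursive_leq.
Qed.

Lemma recursive_if k (b : seq nat -> bool) f g :
    recursive k (fun xs => b xs : nat) -> recursive k f -> recursive k g ->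
  recursive k (fun xs => if b xs then f xs else g xs).
Proof.
move=> hb hf hg.
apply: (eq_recursive (f := fun xs => b xs * f xs + (1 - b xs) * g xs)).
  by move=> xs _; case: (b xs); rewrite ?mul1n ?mul0n ?addn0.
apply: recursive_add; apply: recursive_mul => //.
by apply: recursive_sub => //; apply: recursive_const.
Qed.

(** A function on finitely many arguments is recursive, whatever it is: this is
    what puts the transition table of a machine inside a program. *)
Lemma recursive_nth k (s : seq nat) f :
  recursive k f -> recursive k (fun xs => nth 0 s (f xs)).
Proof.
apply: (recursive_comp1 (f := nth 0 s)).
elim: s => [|c s IH].
  by apply: eq_recursive (recursive_const _ 0) => xs _; rewrite nth_nil.
apply: eq_recursive (recursive_if
  (b := fun xs => arg 0 xs == 0) (f := fun=> c)
  (g := fun xs => nth 0 s (arg 0 xs).-1) _ _ _) => [xs _| | |].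
- by case: (arg 0 xs).
- by apply: recursive_eqn; [apply: recursive_arg|apply: recursive_const].
- exact: recursive_const.
- by apply: recursive_comp1 => //; apply/recursive_pred/recursive_arg.
Qed.

Lemma recursive_divn k f g :
  recursive k f -> recursive k g -> recursive k (fun xs => f xs %/ g xs).
Proof.
apply: recursive_comp2.
apply: (recursive_mu
  (f := fun ys => (0 < arg 2 ys) * ((arg 0 ys).+1 * arg 2 ys <= arg 1 ys))).
- apply: recursive_mul.
    by apply: recursive_leq; [apply: recursive_const|apply: recursive_arg].
  apply: recursive_leq; last exact: recursive_arg.
  apply: recursive_mul; last exact: recursive_arg.
  by apply/recursive_succ/recursive_arg.
- case=> [|x [|b []]] //= _; rewrite /arg /=.
  by case: (posnP b) => [->|b0] //; rewrite leqNgt ltn_ceil // muln0.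
- case=> [|x [|b []]] //= i _; rewrite /arg /=.
  by case: (posnP b) => [->|b0]; rewrite ?divn0 // -leq_divRL // => ->.
Qed.

Lemma recursive_modn k f g :
  recursive k f -> recursive k g -> recursive k (fun xs => f xs %% g xs).
Proof.
move=> hf hg; apply: (eq_recursive (f := fun xs => f xs - f xs %/ g xs * g xs)).
  by move=> xs _; rewrite {1}(divn_eq (f xs) (g xs)) addKn.
by apply: recursive_sub => //; apply: recursive_mul => //; apply: recursive_divn.
Qed.

Lemma recursive_logn2 k f :
  recursive k f -> recursive k (fun xs => logn 2 (f xs)).
Proof.
apply: (recursive_comp1 (f := logn 2)).
apply: (recursive_mu
  (f := fun ys => (0 < arg 1 ys) * (arg 1 ys %% 2 ^ (arg 0 ys).+1 == 0))).
- apply: recursive_mul.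
    by apply: recursive_leq; [apply: recursive_const|apply: recursive_arg].
  apply: recursive_eqn; last exact: recursive_const.
  apply: recursive_modn; first exact: recursive_arg.
  apply: recursive_exp; first exact: recursive_const.
  by apply/recursive_succ/recursive_arg.
- case=> [|z []] //= _; rewrite /arg /=; case: (posnP z) => //= z0.
  by rewrite -/(dvdn _ _) pfactor_dvdn // ltnn.
- case=> [|z []] //= i _; rewrite /arg /=; case: (posnP z) => [->//|z0] ilt.
  by rewrite -/(dvdn _ _) pfactor_dvdn // ilt.
Qed.

(** This pairing is the constructor of [CodeSeq.code]: [CodeSeq.code (x :: s)] is
    [npair x (CodeSeq.code s)] by definition.  Thus the same lemmas serve for
    Goedel numbers and for machine configurations. *)
Definition npair (x y : nat) : nat := 2 ^ x * y.*2.+1.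
Definition nfst (z : nat) : nat := logn 2 z.
Definition nsnd (z : nat) : nat := z %/ 2 ^ logn 2 z %/ 2.

Lemma npairK1 x y : nfst (npair x y) = x.
Proof.
rewrite /nfst /npair lognM ?expn_gt0 // pfactorK // lognE /=.
by rewrite dvdn2 /= odd_double addn0.
Qed.

Lemma npairK2 x y : nsnd (npair x y) = y.
Proof.
rewrite /nsnd -/(nfst _) npairK1 /npair mulKn ?expn_gt0 //.
by rewrite divn2 -uphalfE uphalf_double.
Qed.

Lemma recursive_npair k f g :
  recursive k f -> recursive k g -> recursive k (fun xs => npair (f xs) (g xs)).
Proof.
move=> hf hg; apply: recursive_mul.
  by apply: recursive_exp => //; apply: recursive_const.
apply: recursive_succ.
apply: (eq_recursive (f := fun xs => g xs + g xs)); last exact: recursive_add.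
by move=> xs _; rewrite addnn.
Qed.

Lemma recursive_nfst k f :
  recursive k f -> recursive k (fun xs => nfst (f xs)).
Proof. exact: recursive_logn2. Qed.

Lemma recursive_nsnd k f :
  recursive k f -> recursive k (fun xs => nsnd (f xs)).
Proof.
move=> hf; apply: recursive_divn; last exact: recursive_const.
apply: recursive_divn => //.
by apply: recursive_exp; [apply: recursive_const|apply: recursive_logn2].
Qed.

(** In particular the Goedel number of a composite program is recursive in those
    of its parts. *)
Lemma recursive_code k (gs : seq (seq nat -> nat)) :
    (forall i, i < size gs -> recursive k (nth (fun=> 0) gs i)) ->
  recursive k (fun xs => CodeSeq.code [seq g xs | g <- gs]).
Proof.
elim: gs => [|g gs IH] hgs; first exact: recursive_const.
apply: (recursive_npair (f := g)); first exact: (hgs 0).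
by apply: IH => i; apply: (hgs i.+1).
Qed.

Lemma recursive_godel_const k f :
  recursive k f -> recursive k (fun xs => godel (const_prog (f xs))).
Proof.
apply: (recursive_comp1 (f := fun c => godel (const_prog c))).
apply: eq_recursive (recursive_iteri (n := arg 0) (f := fun=> godel PZero)
  (g := fun ys => CodeSeq.code [:: 3; godel PSucc; arg 1 ys]) _ _ _).
- by move=> xs _; elim: (arg 0 xs) => //= c ->.
- exact: recursive_arg.
- exact: recursive_const.
- apply: (recursive_code (gs := [:: fun=> 3; fun=> godel PSucc; arg 1])).
  by move=> [|[|[]]] // _; do ?[exact: recursive_const|exact: recursive_arg].
Qed.

(** Let [diag e] be the Goedel number of the program obtained from the binary
    program numbered [e] by fixing its second argument to [e].  If [F] computes
    [f k (diag e)], fixing the second argument of [F] to the number of [F] gives a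
    program whose own Goedel number is the [diag] that it passes to [f]. *)
Lemma self_reference (f : nat -> nat -> nat) :
    recursive 2 (fun xs => f (arg 0 xs) (arg 1 xs)) ->
  exists p, forall k, pr_eval p [:: k] (f k (godel p)).
Proof.
move=> hf.
pose diag e := CodeSeq.code [:: 3; e; godel (PProj 0); godel (const_prog e)].
have [F hF] : recursive 2 (fun xs => f (arg 0 xs) (diag (arg 1 xs))).
  apply: (recursive_comp2 hf); first exact: recursive_arg.
  apply: (recursive_code (gs := [:: fun=> 3; arg 1; fun=> godel (PProj 0);
    fun xs => godel (const_prog (arg 1 xs))])).
  move=> [|[|[|[]]]] // _; do ?[exact: recursive_const|exact: recursive_arg].
  by apply/recursive_godel_const/recursive_arg.
exists (PComp F [:: PProj 0; const_prog (godel F)]) => k.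
apply: (@EvComp _ _ _ [:: k; godel F]) => //; last exact: hF.
by case=> [|[]] // _; [apply: EvProj|apply: const_progP].
Qed.

(** * Simulating a Turing machine *)

Section Simulation.
Variable T : turing_machine.

(** The blank is listed first so that its code is the digit [0]: a half-tape is
    then a number in base [base], and the infinitely many blanks at its end are
    leading zeros. *)
Definition symbols : seq (tm_symbol T) := blank T :: enum (tm_symbol T).
Definition base : nat := size symbols.
Definition symbol_code (a : tm_symbol T) : nat := index a symbols.
Definition code_symbol (j : nat) : tm_symbol T := nth (blank T) symbols j.
Definition state_code (q : tm_state T) : nat := index q (enum (tm_state T)).
Definition code_state (j : nat) : tm_state T :=
  nth (start T) (enum (tm_state T)) j.

Lemma symbol_code_lt a : symbol_code a < base.
Proof. by rewrite index_mem inE mem_enum orbT. Qed.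

Lemma symbol_codeK : cancel symbol_code code_symbol.
Proof. by move=> a; apply: nth_index; rewrite inE mem_enum orbT. Qed.

Lemma symbol_code_blank : symbol_code (blank T) = 0.
Proof. by rewrite /symbol_code /= eqxx. Qed.

Lemma state_code_lt q : state_code q < #|tm_state T|.
Proof. by rewrite cardE index_mem mem_enum. Qed.

Lemma state_codeK : cancel state_code code_state.
Proof. by move=> q; apply: nth_index; rewrite mem_enum. Qed.

Definition push (a : tm_symbol T) (t : nat) : nat := symbol_code a + base * t.

Definition stack_code (s : seq (tm_symbol T)) : nat := foldr push 0 s.

Lemma push_mod a t : push a t %% base = symbol_code a.
Proof. by rewrite /push addnC mulnC modnMDl modn_small // symbol_code_lt. Qed.

Lemma push_div a t : push a t %/ base = t.
Proof.
by rewrite /push addnC mulnC divnMDl // divn_small ?addn0 // symbol_code_lt.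
Qed.

Lemma stack_code_mod s : stack_code s %% base = symbol_code (head (blank T) s).
Proof. by case: s => [|a s]; rewrite /= ?push_mod // mod0n symbol_code_blank. Qed.

Lemma stack_code_div s : stack_code s %/ base = stack_code (behead s).
Proof. by case: s => [|a s]; rewrite /= ?push_div // div0n. Qed.

Lemma stack_code_pad s :
  push (head (blank T) s) (stack_code (behead s)) = stack_code s.
Proof. by case: s => //=; rewrite /push symbol_code_blank muln0. Qed.

(** The scanned symbol is stored as the top of the right half-tape. *)
Definition config_code (c : config T) : nat :=
  npair (state_code (cf_state c))
    (npair (stack_code (cf_left c)) (push (cf_head c) (stack_code (cf_right c)))).

(** State and scanned symbol are merged into the single index
    [state_code q * base + symbol_code a]; [f] selects one component of the
    transition. *)
Definition delta_table (f : tm_state T * tm_symbol T * move -> nat) : seq nat :=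
  mkseq (fun j => f (delta (code_state (j %/ base)) (code_symbol (j %% base))))
    (#|tm_state T| * base).

Definition next_config (z : nat) : nat :=
  let q := nfst z in let l := nfst (nsnd z) in let r := nsnd (nsnd z) in
  let j := q * base + r %% base in
  let q' := nth 0 (delta_table (fun d => state_code d.1.1)) j in
  let a' := nth 0 (delta_table (fun d => symbol_code d.1.2)) j in
  let d := nth 0 (delta_table
    (fun d => match d.2 with MLeft => 0 | MStay => 1 | MRight => 2 end)) j in
  let r' := a' + base * (r %/ base) in
  npair q' (if d == 0 then npair (l %/ base) (l %% base + base * r')
           else if d == 1 then npair l r'
           else npair (a' + base * l) (r %/ base)).

Lemma nth_delta_table f q a :
  nth 0 (delta_table f) (state_code q * base + symbol_code a) = f (delta q a).
Proof.
have alt := symbol_code_lt a; have qlt := state_code_lt q.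
rewrite nth_mkseq.
  rewrite divnMDl // divn_small // addn0 modnMDl modn_small //.
  by rewrite state_codeK symbol_codeK.
apply: (@leq_trans ((state_code q).+1 * base)).
  by rewrite mulSn addnC ltn_add2r.
by rewrite leq_mul2r qlt orbT.
Qed.

Lemma next_configE c : next_config (config_code c) = config_code (tm_step c).
Proof.
case: c => q l a r; rewrite /next_config /config_code /= !(npairK1, npairK2).
rewrite push_mod push_div !nth_delta_table /=.
case: (delta q a) => -[q' a'] [] /=.
- by rewrite stack_code_div stack_code_mod.
- by [].
- by rewrite stack_code_pad.
Qed.

Lemma config_code_iter k c :
  iter k next_config (config_code c) = config_code (iter k (@tm_step T) c).
Proof. by elim: k => //= k ->; rewrite next_configE. Qed.

Lemma recursive_next_config k f :
  recursive k f -> recursive k (fun xs => next_config (f xs)).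
Proof.
apply: recursive_comp1.
have cst := recursive_const 1; have z := @recursive_arg 1 0 isT.
have q := recursive_nfst z.
have l := recursive_nfst (recursive_nsnd z).
have r := recursive_nsnd (recursive_nsnd z).
have rm := recursive_modn r (cst base).
have rd := recursive_divn r (cst base).
have j := recursive_add (recursive_mul q (cst base)) rm.
have a' := recursive_nth (delta_table (fun d => symbol_code d.1.2)) j.
have r' := recursive_add a' (recursive_mul (cst base) rd).
apply: recursive_npair; first exact: recursive_nth.
apply: recursive_if.
- by apply: recursive_eqn => //; apply: recursive_nth.
- apply: recursive_npair; first exact: recursive_divn.
  apply: recursive_add; first exact: recursive_modn.
  exact: recursive_mul.
- apply: recursive_if.
  + by apply: recursive_eqn => //; apply: recursive_nth.
  + exact: recursive_npair.
  + by apply: recursive_npair => //; apply: recursive_add => //; apply: recursive_mul.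
Qed.

(** [base * t] puts the blank that terminates the unary number. *)
Definition write (e t : nat) : nat := iter e (push (mark T)) (base * t).

Lemma stack_code_tape es : stack_code (tape_of T es) = foldr write 0 es.
Proof.
elim: es => //= e es <-; rewrite /stack_code /tape_of /= foldr_cat foldr_rcons.
rewrite /push symbol_code_blank add0n -/(push _) /write.
by elim: e => //= e ->.
Qed.

Lemma config_code_init es :
  config_code (tm_init T es) =
    npair (state_code (start T)) (npair 0 (foldr write 0 es)).
Proof. by rewrite -stack_code_tape /config_code /= stack_code_pad. Qed.

Lemma recursive_write k f g :
  recursive k f -> recursive k g -> recursive k (fun xs => write (f xs) (g xs)).
Proof.
apply: recursive_comp2.
apply: eq_recursive (recursive_iteri (n := arg 0) (f := fun xs => base * arg 1 xs)
  (g := fun ys => push (mark T) (arg 1 ys)) _ _ _) => [xs _| | |].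
- by rewrite /write; elim: (arg 0 xs) => //= m ->.
- exact: recursive_arg.
- apply: recursive_mul; first exact: recursive_const.
  exact: recursive_arg.
- apply: recursive_add; first exact: recursive_const.
  by apply: recursive_mul; [apply: recursive_const|apply: recursive_arg].
Qed.

(** The inscription [s p] depends on [p] only through its Goedel number, and in a
    recursive way.  Quantifying over the tape [t] in front of which it is written
    makes the property stable under concatenation. *)
Definition writable (s : prog -> seq nat) : Prop :=
  exists2 h : nat -> nat -> nat,
    recursive 2 (fun xs => h (arg 0 xs) (arg 1 xs)) &
    forall p t, h (godel p) t = foldr write t (s p).

Lemma writable_const (es : seq nat) : writable (fun=> es).
Proof.
exists (fun _ t => foldr write t es) => //.
elim: es => [|e es IH]; first exact: (@recursive_arg 2 1).
by apply: recursive_write => //; apply: recursive_const.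
Qed.

Lemma writable_cons (h : nat -> nat) s :
    recursive 1 (fun xs => h (arg 0 xs)) -> writable s ->
  writable (fun p => h (godel p) :: s p).
Proof.
move=> rh [w rw ew]; exists (fun g t => write (h g) (w g t)) => [|p t /=].
  by apply: recursive_write => //; apply: recursive_comp1 rh _; apply: recursive_arg.
by rewrite ew.
Qed.

Lemma writable_cat s1 s2 :
  writable s1 -> writable s2 -> writable (fun p => s1 p ++ s2 p).
Proof.
move=> [h1 r1 e1] [h2 r2 e2]; exists (fun g t => h1 g (h2 g t)).
  by apply: (recursive_comp2 r1) => //; apply: recursive_arg.
by move=> p t; rewrite foldr_cat -e2 -e1.
Qed.

Lemma writable_flatten (I : Type) (r : seq I) (s : I -> prog -> seq nat) :
    (forall i, writable (s i)) ->
  writable (fun p => flatten [seq s i p | i <- r]).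
Proof.
move=> us; elim: r => [|i r IH] /=; first exact: writable_const.
exact: writable_cat.
Qed.

Definition stopped (es : seq nat) (k : nat) : bool :=
  cf_state (iter k (@tm_step T) (tm_init T es)) == stop T.

Lemma recursive_stopped s : writable s ->
  exists2 h : nat -> nat -> bool,
    recursive 2 (fun xs => h (arg 0 xs) (arg 1 xs) : nat) &
    forall k p, h k (godel p) = stopped (s p) k.
Proof.
move=> [w rw ew].
pose init g := npair (state_code (start T)) (npair 0 (w g 0)).
exists (fun k g => nfst (iter k next_config (init g)) == state_code (stop T)).
  apply: recursive_eqn; last exact: recursive_const.
  apply: recursive_nfst.
  apply: eq_recursive (recursive_iteri (n := arg 0)
    (f := fun xs => init (arg 1 xs))
    (g := fun ys => next_config (arg 1 ys)) _ _ _) => [xs _| | |].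
  - by elim: (arg 0 xs) => //= m ->.
  - exact: recursive_arg.
  - apply: recursive_npair; first exact: recursive_const.
    apply: recursive_npair; first exact: recursive_const.
    apply: (recursive_comp2 rw); first exact: recursive_arg.
    exact: recursive_const.
  - by apply/recursive_next_config/recursive_arg.
move=> k p; rewrite /init ew -config_code_init config_code_iter npairK1.
exact/inj_eq/(can_inj state_codeK).
Qed.

End Simulation.

(** * Halting times *)

(** The counter climbs until it meets [P] and then stays there, so that after [n]
    rounds it is the minimum of [n] and the first index satisfying [P]. *)
Definition search (P : pred nat) (n : nat) : nat :=
  iter n (fun i => if P i then i else i.+1) 0.

Lemma search_none (P : pred nat) n : (forall i, ~~ P i) -> search P n = n.
Proof. by move=> nP; elim: n => //= n ->; rewrite (negbTE (nP n)). Qed.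

Lemma search_min (P : pred nat) m n :
  P m -> (forall i, P i -> m <= i) -> search P n = minn m n.
Proof.
move=> Pm minm; elim: n => [|n IH]; first by rewrite minn0.
rewrite [LHS]/= -/(search P n) IH; case: (leqP m n) => [mn|nm].
  by rewrite Pm; apply/esym/minn_idPl/leqW.
rewrite (minn_idPr nm).
by case: ifP => // /minm; rewrite leqNgt nm.
Qed.

Lemma recursive_search k (h : nat -> nat -> bool) f g :
    recursive 2 (fun xs => h (arg 0 xs) (arg 1 xs) : nat) ->
    recursive k f -> recursive k g ->
  recursive k (fun xs => search (h^~ (g xs)) (f xs)).
Proof.
move=> rh.
apply: (recursive_comp2 (f := fun n x => search (h^~ x) n)).
apply: eq_recursive (recursive_iteri (n := arg 0) (f := fun=> 0)
  (g := fun ys => if h (arg 1 ys) (arg 3 ys) then arg 1 ys else (arg 1 ys).+1)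
  _ _ _) => [[|n [|x []]] //= _| | |].
- exact: recursive_arg.
- exact: recursive_const.
- apply: recursive_if; last by apply/recursive_succ/recursive_arg.
    apply: (recursive_comp2 (f := fun x y => h x y : nat) rh).
      exact: recursive_arg.
    exact: recursive_arg.
  exact: recursive_arg.
Qed.

(** A program can know how long [T] runs on an inscription that mentions the program
    itself. *)
Lemma self_timer (T : turing_machine) (s : prog -> seq nat) :
    writable T s ->
  exists p, forall k,
    pr_eval p [:: k] (2 ^ search (@stopped T (s p)) k.+1).
Proof.
case/recursive_stopped=> h rh eh.
have [|p hp] := @self_reference (fun k g => 2 ^ search (h^~ g) k.+1).
  apply: recursive_exp; first exact: recursive_const.
  apply: recursive_search => //; last exact: recursive_arg.
  by apply/recursive_succ/recursive_arg.
exists p => k; rewrite (_ : @stopped T (s p) = h^~ (godel p)) //.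
by apply: boolp.funext => i; rewrite eh.
Qed.

Import Order.TTheory GRing.Theory Num.Theory.
Local Open Scope ring_scope.

(** * A computable real that vanishes iff a search fails *)

(** If [P] first holds at [m], then [e = 2 ^- m] is reached by the approximations at
    precision [m - 1]; before that they are [2 ^- k.+1], which is within [2 ^- k] of
    [0] and of every [2 ^- m] with [m > k]. *)
Lemma halting_real (R : realType) (P : pred nat) :
  exists e : R, [/\ 0 <= e <= 1, e = 0 <-> ~ (exists i, P i)
    & forall k, `|e - (2 ^ search P k.+1)%:R^-1| < 2 ^- k].
Proof.
case: (EM (exists i, P i)) => [exP|nP].
  have [m Pm minm] := ex_minnP exP.
  have e_gt0 : 0 < 2 ^- m :> R by rewrite invr_gt0 exprn_gt0.
  exists (2 ^- m); split.
  - by rewrite (ltW e_gt0) invf_le1 ?exprn_gt0 // exprn_ege1 // ler1n.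
  - by split=> [e0|[]//]; rewrite e0 ltxx in e_gt0.
  - move=> k; rewrite (search_min _ Pm) // natrX.
    have [mk|km] := leqP m k.+1; first by rewrite subrr normr0 invr_gt0 exprn_gt0.
    have lt1 : 2 ^- m < 2 ^- k.+1 :> R.
      by rewrite ltf_pV2 ?posrE ?exprn_gt0 // ltr_eXn2l // ltr1n.
    have lt2 : 2 ^- k.+1 < 2 ^- k :> R.
      by rewrite ltf_pV2 ?posrE ?exprn_gt0 // ltr_eXn2l // ltr1n.
    rewrite ltr_distlC; apply/andP; split; lra.
have nP' i : ~~ P i by apply/negP => Pi; apply: nP; exists i.
exists 0; split=> // [|k]; first by rewrite lexx ler01.
rewrite search_none // sub0r normrN natrX ger0_norm ?invr_ge0 ?exprn_ge0 //.
by rewrite ltf_pV2 ?posrE ?exprn_gt0 // ltr_eXn2l // ltr1n.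
Qed.

Definition pred_prog : prog := PRec PZero (PProj 0).

Lemma pred_progP n : pr_eval pred_prog [:: n] n.-1.
Proof.
elim: n => [|n IH]; first exact/EvRec0/EvZero.
by apply: EvRecS IH _; apply: (@EvProj 0 [:: n; n.-1]).
Qed.

Definition bit_descr (b : bool) : real_descr :=
  RealDescr (const_prog b) (const_prog 1) PZero.
Definition inv_descr (p : prog) : real_descr := RealDescr (const_prog 1) p PZero.
Definition one_sub_inv_descr (p : prog) : real_descr :=
  RealDescr (PComp pred_prog [:: p]) p PZero.

Section Descriptions.
Variables (R : realType) (p : prog) (b : nat -> nat) (e : R).
Hypothesis pE : forall k, pr_eval p [:: k] (b k).
Hypothesis b_gt0 : forall k, (0 < b k)%N.
Hypothesis eE : forall k, `|e - (b k)%:R^-1| < 2 ^- k.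

Lemma bit_descrP (c : bool) : describes_real (bit_descr c) (c%:R : R).
Proof.
move=> k; exists c, 1%N, 0%N; split=> //; try exact: const_progP.
  exact: EvZero.
by rewrite mul1r divr1 subrr normr0 invr_gt0 exprn_gt0.
Qed.

Lemma inv_descrP : describes_real (inv_descr p) e.
Proof.
move=> k; exists 1%N, (b k), 0%N; split=> //; try exact: const_progP.
- exact: EvZero.
- by rewrite -lt0n.
- by rewrite !mul1r.
Qed.

Lemma one_sub_inv_descrP : describes_real (one_sub_inv_descr p) (1 - e).
Proof.
move=> k; exists (b k).-1, (b k), 0%N; split=> //.
- apply: (@EvComp _ _ _ [:: b k]) => //; last exact: pred_progP.
  by case.
- exact: EvZero.
- by rewrite -lt0n.
- have b0 : (b k)%:R != 0 :> R by rewrite pnatr_eq0 -lt0n.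
  rewrite mul1r -subn1 natrB // mulrBl divff // mul1r.
  have -> : 1 - e - (1 - (b k)%:R^-1) = - (e - (b k)%:R^-1) by ring.
  by rewrite normrN.
Qed.

End Descriptions.

Lemma writable_inv_descr (T : turing_machine) :
  writable T (fun p => real_descr_codes (inv_descr p)).
Proof.
apply: (writable_cons (h := fun=> godel (const_prog 1))); first exact: recursive_const.
apply: (writable_cons (h := id)); first exact: recursive_arg.
exact: (writable_const T [:: godel PZero]).
Qed.

Lemma writable_one_sub_inv_descr (T : turing_machine) :
  writable T (fun p => real_descr_codes (one_sub_inv_descr p)).
Proof.
apply: (writable_cons (h := fun g => CodeSeq.code [:: 3; godel pred_prog; g]%N)).
  apply: (recursive_code (gs := [:: fun=> 3; fun=> godel pred_prog; arg 0]%N)).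
  by move=> [|[|[]]] // _; do ?[exact: recursive_const|exact: recursive_arg].
apply: (writable_cons (h := id)); first exact: recursive_arg.
exact: (writable_const T [:: godel PZero]).
Qed.

(** * The channel *)

Section ZChannel.
Variables (R : realType) (X Y : finType) (x0 x1 : X) (y0 y1 : Y).
Hypotheses (x01 : x0 != x1) (y01 : y0 != y1).

(** On the letters [x0], [x1], [y0], [y1] this is the Z-channel with crossover
    probability [e]; the other inputs behave as [x1] and the other outputs never
    occur. *)
Definition zchannel (e : R) : channel R X Y := fun x y =>
  if y == y0 then (if x == x0 then 1 else e)
  else if y == y1 then (if x == x0 then 0 else 1 - e)
  else 0.

Lemma zchannel_distr e x : 0 <= e <= 1 -> is_distr (zchannel e x).
Proof.
move=> /andP[e0 e1]; split=> [y|].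
  rewrite /zchannel; do 2 (case: ifP => // _); case: ifP => // _.
  by rewrite subr_ge0.
rewrite (bigD1 y0) //= (bigD1 y1) 1?eq_sym //= big1 => [|y /andP[/negbTE h0 /negbTE h1]].
  rewrite /zchannel !eqxx (eq_sym y1) (negbTE y01) addr0.
  by case: ifP; rewrite ?addr0 // addrC subrK.
by rewrite /zchannel h0 h1.
Qed.

(** Every input word yields the output word [y0 ... y0] with positive probability,
    so that no two supports are disjoint. *)
Lemma C0FB_zchannel_pos e : 0 < e -> C0FB (zchannel e) = 0%E.
Proof.
move=> e0; rewrite /C0FB.
suff -> : C0 (zchannel e) = 0%E by rewrite eqxx.
have orth1 m : (max_orthogonal (zchannel e) m <= 1)%N.
  apply/bigmax_leqP => S /forall_inP hS.
  apply/card_le1_eqP => xs xs' xsS xs'S; apply/eqP; apply: contraT => ne.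
  have /forall_inP/(_ _ xs'S) := hS _ xsS.
  rewrite eq_sym ne => /forallP/(_ [tuple of nseq m y0]).
  have pos us : channel_pow (zchannel e) us [tuple of nseq m y0] != 0.
    apply/prodf_neq0 => j _.
    rewrite (tnth_nth y0) nth_nseq ltn_ord /zchannel eqxx.
    by case: ifP => _; rewrite ?oner_eq0 // gt_eqF.
  by rewrite !(negbTE (pos _)).
rewrite /C0 (_ : (fun _ => _) = cst 0%E).
  by have [-> _] := @cvg_limn_einf_sup R (cst 0%E) _ (cvg_cst _).
apply/funext => m /=; congr (_%:E).
case: (max_orthogonal _ m) (orth1 m) => [|[]] // _.
  by rewrite /log2 ln0 // mul0r mulr0.
by rewrite /log2 ln1 mul0r mulr0.
Qed.

(** Without noise the words over [x0] and [x1] are pairwise orthogonal: at a place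
    where two of them differ, [y0] comes only from [x0], and [y1] only from [x1]. *)
Lemma max_orthogonal_zchannel0 m : (2 ^ m <= max_orthogonal (zchannel 0) m)%N.
Proof.
pose word (bs : m.-tuple bool) := map_tuple (fun b : bool => if b then x0 else x1) bs.
have word_inj : injective word.
  move=> bs bs' /(congr1 val) /= h; apply/val_inj/(inj_map _ h).
  by case=> [] [] // /eqP; rewrite ?(negbTE x01) // eq_sym (negbTE x01).
have <- : #|[set word bs | bs : m.-tuple bool]| = (2 ^ m)%N.
  by rewrite card_imset // card_tuple card_bool.
apply: (@leq_bigmax_cond _ _ (fun S : {set m.-tuple X} => #|S|)).
apply/forall_inP => _ /imsetP[bs _ ->]; apply/forall_inP => _ /imsetP[bs' _ ->].
apply/implyP => ne; apply/forallP => ys.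
have /existsP[j] : [exists j, tnth bs j != tnth bs' j].
  apply: contraR ne => /existsPn h; apply/eqP; congr word.
  by apply: eq_from_tnth => j; apply/eqP/negbNE.
have W0 (b : bool) y : zchannel 0 (if b then x0 else x1) y != 0 -> b = (y == y0).
  rewrite /zchannel; case: b; rewrite ?eqxx ?(eq_sym x1) ?(negbTE x01);
  do 2?[case: ifP => //]; by rewrite eqxx.
apply: contraR; rewrite negb_or => /andP[/prodf_neq0 h /prodf_neq0 h'].
have := h j isT; have := h' j isT.
by rewrite /= !tnth_map => /W0 -> /W0 ->.
Qed.

Lemma C0_zchannel0 : (1 <= C0 (zchannel 0))%E.
Proof.
have ln2_gt0 : 0 < ln 2 :> R by rewrite ln_gt0 // ltr1n.
rewrite /C0 limn_einf_lim; apply: lime_ge; first exact: is_cvg_einfs.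
near=> m; apply: le_ereal_inf_tmp => _ [k /= mk <-].
have k_gt0 : (0 < k)%N by apply: leq_trans mk; near: m; exact: nbhs_infty_gt.
rewrite lee_fin mulrC ler_pdivlMr ?ltr0n // mul1r /log2 ler_pdivlMr //.
rewrite mulr_natl -lnXn // ler_ln ?posrE ?exprn_gt0 // ?ltr0n.
  by rewrite -natrX ler_nat max_orthogonal_zchannel0.
by apply: leq_trans (max_orthogonal_zchannel0 k); rewrite expn_gt0.
Unshelve. all: by end_near.
Qed.

Lemma elog2_inv_ge1 (s : R) : 0 <= s <= 2^-1 -> (1 <= elog2 (s%:E^-1))%E.
Proof.
move=> /andP[s0 s2]; have ln2_gt0 : 0 < ln 2 :> R by rewrite ln_gt0 // ltr1n.
rewrite /elog2 inver; case: eqP => [_|/eqP sn0].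
  by rewrite /= gt0_mulye ?leey // lte_fin invr_gt0.
have s_gt0 : 0 < s by rewrite lt_neqAle eq_sym sn0.
rewrite lne_EFin ?invr_gt0 // -EFinM lee_fin ler_pdivlMr // mul1r.
by rewrite ler_ln ?posrE ?invr_gt0 // -[leLHS]invrK lef_pV2 ?posrE ?invr_gt0.
Qed.

(** The uniform distribution on [x0] and [x1] achieves one bit: each output letter
    excludes [x0] or [x1], so that the inputs compatible with it have total
    probability at most [1/2]. *)
Lemma C0FB_zchannel0 : (1 <= C0FB (zchannel 0))%E.
Proof.
rewrite /C0FB gt_eqF ?(lt_le_trans _ C0_zchannel0) //.
pose P x : R := 2^-1 * ((x == x0)%:R + (x == x1)%:R).
have sum1 (a : X) : \sum_x (x == a)%:R = 1 :> R.
  by rewrite (bigD1 a) //= big1 ?eqxx ?addr0 // => x /negbTE ->.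
have sumP : \sum_x P x = 1.
  by rewrite -mulr_sumr big_split /= !sum1 mulVf // pnatr_eq0.
have P0 x : 0 <= P x by rewrite mulr_ge0 ?invr_ge0 ?ler0n // addr_ge0 ?ler0n.
apply: (@le_trans _ _ (\big[mine/+oo%E]_(y : Y)
  elog2 ((\sum_(x | 0 < zchannel 0 x y) P x)%:E^-1)%E)); last first.
  by apply: ereal_sup_ubound; exists P.
apply: (big_ind (fun u => (1 <= u)%E)) => [|u v hu hv|y _]; first exact: leey.
  by rewrite le_min hu.
apply: elog2_inv_ge1; rewrite sumr_ge0 //=.
(* [xb] is the letter among [x0] and [x1] that [y] excludes *)
have [xb hxb Wxb] : exists2 xb, P xb = 2^-1 & ~~ (0 < zchannel 0 xb y).
  have [yy0|yny0] := eqVneq y y0.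
    exists x1; first by rewrite /P eqxx eq_sym (negbTE x01) add0r mulr1.
    by rewrite /zchannel yy0 eqxx eq_sym (negbTE x01) ltxx.
  exists x0; first by rewrite /P eqxx (negbTE x01) addr0 mulr1.
  by rewrite /zchannel (negbTE yny0) eqxx; case: ifP; rewrite ltxx.
have -> : 2^-1 = \sum_(x | x != xb) P x.
  by move: sumP; rewrite (bigD1 xb) //= hxb => /(canRL (addKr _)) ->; field.
rewrite [leLHS]big_mkcond [leRHS]big_mkcond ler_sum //= => x _.
case: ifP => [W|_]; last by case: ifP.
by case: eqP W Wxb => // -> ->.
Qed.

End ZChannel.

(** * The identity plant *)

Lemma spectrum1 (R : realType) (n : nat) z :
  z \in spectrum (1%:M : 'M[R]_n) -> z = 1.
Proof.
rewrite /spectrum; case: closed_field_poly_normal => s /= hs zs.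
have : eigenvalue (complex_mx (1%:M : 'M[R]_n)) z.
  rewrite eigenvalue_root_char hs rootZ ?root_prod_XsubC //.
  by rewrite lead_coef_eq0 monic_neq0 // char_poly_monic.
case/eigenvalueP => v; rewrite /complex_mx map_mx1 mulmx1 => vz v0.
apply/eqP; rewrite -subr_eq0; apply: contraNT v0 => z1.
have : (z - 1) *: v == 0 by rewrite scalerBl scale1r -vz subrr.
by rewrite scaler_eq0 (negbTE z1).
Qed.

Lemma normc1 (R : realType) : Normc.normc (1 : R[i]) = 1.
Proof. by rewrite /= expr1n expr0n addr0 sqrtr1. Qed.

Lemma eta1 (R : realType) (n : nat) : eta (1%:M : 'M[R]_n) = 0.
Proof.
rewrite /eta big_seq_cond big1 // => z /andP[/spectrum1 -> _].
by rewrite normc1 /log2 ln1 mul0r.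
Qed.

Lemma plants1 (R : realType) (n : nat) : (0 < n)%N -> plants R n 1%:M.
Proof.
move=> n0; split=> [i j|].
  by rewrite mxE; exists (bit_descr (i == j)); apply: bit_descrP.
exists 1; last by rewrite normc1.
apply/eigenvalueP; exists (const_mx 1).
  by rewrite /complex_mx map_mx1 mulmx1 scale1r.
apply/eqP => /rowP/(_ (Ordinal n0)); rewrite !mxE; exact/eqP/oner_neq0.
Qed.

(** * The diagonal argument *)

Theorem theorem27 (R : realType) (n : nat) (X Y : finType)
    (hn : (0 < n)%N) (hX : (1 < #|X|)%N) (hY : (1 < #|Y|)%N) :
  ~ semi_decidable (@describes_pair R n X Y)
      (plants R n `*` channels R X Y)%classic
      (S_FB_SE_solvable R n X Y).
Proof.
move=> [T hT].
have /card_gt1P[x0 [x1 [_ _ x01]]] := hX.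
have /card_gt1P[y0 [y1 [_ _ y01]]] := hY.
pose dA (i j : 'I_n) := bit_descr (i == j).
pose dW p x y :=
  if y == y0 then (if x == x0 then bit_descr true else inv_descr p)
  else if y == y1 then (if x == x0 then bit_descr false else one_sub_inv_descr p)
  else bit_descr false.
pose inscription p := flatten
  ([seq real_descr_codes (dA i j) | i <- enum 'I_n, j <- enum 'I_n] ++
   [seq real_descr_codes (dW p x y) | x <- enum X, y <- enum Y]).
have us : writable T inscription.
  rewrite /inscription.
  under [X in writable T X]boolp.funext do rewrite flatten_cat.
  apply: writable_cat; first exact: writable_const.
  rewrite (_ : (fun p => _) = fun p => flatten [seq
    real_descr_codes (dW p xy.1 xy.2) | xy <- [seq (x, y) | x <- enum X, y <- enum Y]]).
    apply: writable_flatten => xy.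
    have const_bit b := writable_const T (real_descr_codes (bit_descr b)).
    rewrite /dW; case: (xy.2 == y0); case: (xy.1 == x0).
    - exact: const_bit.
    - exact: writable_inv_descr.
    - case: (xy.2 == y1); exact: const_bit.
    - case: (xy.2 == y1); last exact: const_bit.
      exact: writable_one_sub_inv_descr.
  apply/funext => p; congr flatten; exact/esym/map_allpairs.
have [p hp] := self_timer us.
have [e [e01 e0 he]] := halting_real R (@stopped T (inscription p)).
have b_gt0 k : (0 < 2 ^ search (@stopped T (inscription p)) k.+1)%N.
  by rewrite expn_gt0.
have dWP x y : describes_real (dW p x y) (zchannel x0 y0 y1 e x y).
  rewrite /dW /zchannel; case: ifP => _.
    by case: ifP => _; [apply: bit_descrP|apply: inv_descrP hp b_gt0 he].
  case: ifP => _; last exact: bit_descrP.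
  by case: ifP => _; [apply: bit_descrP|apply: one_sub_inv_descrP hp b_gt0 he].
have WP : channels R X Y (zchannel x0 y0 y1 e).
  by split=> [x|x y]; [apply: zchannel_distr|exists (dW p x y)].
have := hT (1%:M, zchannel x0 y0 y1 e) (inscription p).
case.
- by split=> //; apply: plants1.
- exists dA, (dW p); split=> // i j; rewrite mxE; exact: bit_descrP.
have haltsE : halts T (inscription p) <-> exists k, @stopped T (inscription p) k.
  by split=> -[k hk]; exists k; apply/eqP.
case: (EM (halts T (inscription p))) => [hh|nh] h1 h2.
  have [_ _] := h1 hh; rewrite /= eta1 C0FB_zchannel_pos ?ltxx //.
  rewrite lt_neqAle eq_sym (andP e01).1 andbT; apply/eqP => /e0; apply.
  exact/haltsE.
apply/nh/h2; split=> //; first exact: plants1.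
rewrite /= eta1 (_ : e = 0); last by apply/e0 => /haltsE.
by apply: (lt_le_trans lte01); apply: C0FB_zchannel0 x01.
Qed.
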